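(* Consider two samples $X_i(t)=\mu(t)+\varepsilon_i(t)$, $1\le i\le N$, and $X^*_j(t)=\mu^*(t)+\varepsilon^*_j(t)$, $1\le j\le M$, $t\in[0,1]$, with $\mu,\mu^*\in L^2([0,1])$. Suppose $(\varepsilon_i)$ satisfies: $\varepsilon_i=f(\delta_i,\delta_{i-1},\ldots)$ with $(\delta_i)$ i.i.d. in a measurable space $S$ and $f:S^\infty\to L^2$ measurable; $\sum_{m\ge1}(E\int_0^1(\varepsilon_i(t)-\varepsilon_{i,m}(t))^2dt)^{1/2}<\infty$, where $\varepsilon_{i,m}=f(\delta_i,\ldots,\delta_{i-m+1},\delta^{(m)}_{i,i-m},\delta^{(m)}_{i,i-m-1},\ldots)$ with $(\delta^{(m)}_{i,k})_k$ independent copies of $(\delta_k)$; $E\varepsilon_0=0$ in $L^2$; $\int_0^1E\varepsilon_0^2(t)dt<\infty$. Suppose $(\varepsilon^*_j)$ satisfies the same conditions. Suppose $\{\varepsilon_i,1\le i\le N\}$ and $\{\varepsilon^*_j,1\le j\le M\}$ are independent, that $H_A:\mu\ne\mu^*$ (i.e. $\int_0^1(\mu-\mu^* )^2dt>0$) holds, and that $N/(N+M)\to\theta$ for some $0\le\theta\le1$ as $\min(M,N)\to\infty$. With $\bar X_N=N^{-1}\sum_{i=1}^NX_i$, $\bar X^*_M=M^{-1}\sum_{j=1}^MX^*_j$ and $U_{N,M}=\frac{NM}{N+M}\int_0^1(\bar X_N(t)-\bar X^*_M(t))^2dt$, we have $$\frac{N+M}{NM}U_{N,M}\to\int_0^1(\mu(t)-\mu^*(t))^2dt\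 \text{ in probability}.$$ In particular, if $0<\theta<1$, then $U_{N,M}\to\infty$ in probability.
   Context: $L^2=L^2([0,1])$; limits are as $\min(M,N)\to\infty$. *)

(* Defs.v *)
From HB Require Import structures.
From mathcomp Require Import all_boot all_order all_algebra.
From mathcomp Require Import all_classical all_reals all_analysis.
Set Implicit Arguments. Unset Strict Implicit. Unset Printing Implicit Defensive.
Import Order.TTheory GRing.Theory Num.Theory.
Import numFieldNormedType.Exports.
Local Open Scope classical_set_scope.
Local Open Scope ring_scope.

Definition int01 {R : realType} (h : R -> \bar R) : \bar R :=
  (\int[@lebesgue_measure R]_(t in `[(0%R:R), (1%R:R)]) h t)%E.

Definition L2fun {R : realType} (g : R -> R) : Prop :=
  measurable_fun `[(0%R:R), (1%R:R)] g /\ (int01 (fun t => ((g t) ^+ 2)%:E) < +oo)%E.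

Definition L2sub (R : realType) := {g : R -> R | L2fun g}.

Definition ip01 {R : realType} (h g : R -> R) : R := fine (int01 (fun t => (h t * g t)%:E)).

Definition mutual_indep {d dS} {Om : measurableType d} {S : measurableType dS}
  {R : realType} (P : probability Om R) {I : eqType} (X : I -> Om -> S) : Prop :=
  (forall i, measurable_fun setT (X i)) /\
  forall (s : seq I) (A : I -> set S), uniq s -> (forall i, measurable (A i)) ->
    P (\big[setI/setT]_(i <- s) (X i @^-1` A i)) =
    (\prod_(i <- s) P (X i @^-1` A i))%E.

Definition iid {d dS} {Om : measurableType d} {S : measurableType dS}
  {R : realType} (P : probability Om R) {I : eqType} (X : I -> Om -> S) : Prop :=
  mutual_indep P X /\
  forall i j (A : set S), measurable A -> P (X i @^-1` A) = P (X j @^-1` A).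

(* Independence of two families of real random variables
   (i.e. of the sigma-algebras they generate). *)
Definition indep_families {d} {Om : measurableType d} {R : realType}
  (P : probability Om R) {I J : Type} (X : I -> Om -> R) (Y : J -> Om -> R) : Prop :=
  forall (s : seq I) (t : seq J) (A : I -> set R) (B : J -> set R),
    (forall i, measurable (A i)) -> (forall j, measurable (B j)) ->
    P (\big[setI/setT]_(i <- s) (X i @^-1` A i) `&`
       \big[setI/setT]_(j <- t) (Y j @^-1` B j)) =
    (P (\big[setI/setT]_(i <- s) (X i @^-1` A i)) *
     P (\big[setI/setT]_(j <- t) (Y j @^-1` B j)))%E.

(* Generators of the product sigma-algebra on S^N x R (cylinder rectangles). *)
Definition cyl_rect {dS} {S : measurableType dS} {R : realType}
  : set (set ((nat -> S) * R)) :=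
  [set C | exists (k : nat) (A : set S) (B : set R), measurable A /\ measurable B /\
      C = (fun p => p.1 k) @^-1` A `&` (fun p => p.2) @^-1` B].

(* f : S^infty -> L^2([0,1]) measurable: realised as a jointly measurable
   kernel (s, t) |-> f s t on S^N x [0,1], with f s in L^2 for every s. *)
Definition shift_measurable {dS} {S : measurableType dS} {R : realType}
  (f : (nat -> S) -> R -> R) : Prop :=
  (forall B : set R, measurable B ->
     <<s cyl_rect >> ([set p | p.2 \in `[(0%R:R), (1%R:R)]] `&` (fun p => f p.1 p.2) @^-1` B))
  /\ forall s, L2fun (f s).

Definition shift_proc {d dS} {Om : measurableType d} {S : measurableType dS}
  {R : realType} (delta : int -> Om -> S) (f : (nat -> S) -> R -> R)
  (i : int) (w : Om) : R -> R :=
  f (fun k : nat => delta (i - k%:Z) w).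

Definition shift_proc_m {d dS} {Om : measurableType d} {S : measurableType dS}
  {R : realType} (delta : int -> Om -> S) (deltac : nat -> int -> int -> Om -> S)
  (f : (nat -> S) -> R -> R) (m : nat) (i : int) (w : Om) : R -> R :=
  f (fun k : nat => if (k < m)%N then delta (i - k%:Z) w
                    else deltac m i (i - k%:Z) w).

(* The assumptions on an error sequence (Bernoulli shift, L^2-m-approximability,
   mean zero, finite second moment). [deltac m i] is the independent copy
   (delta^(m)_{i,k})_k of (delta_k)_k used to build eps_{i,m}. *)
Definition error_assumptions {d dS} {Om : measurableType d} {S : measurableType dS}
  {R : realType} (P : probability Om R) (delta : int -> Om -> S)
  (deltac : nat -> int -> int -> Om -> S) (f : (nat -> S) -> R -> R) : Prop :=
  [/\ iid P delta,
   (forall (m : nat) (i : int), (0 < m)%N ->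
      iid P (fun k : int + int => match k with
                                  | inl k => delta k
                                  | inr k => deltac m i k end)),
   shift_measurable f &
   [/\ (forall i : int,
      (\sum_(1 <= m <oo)
         sqrte (\int[P]_w int01 (fun t =>
            ((shift_proc delta f i w t - shift_proc_m delta deltac f m i w t) ^+ 2)%:E))
       < +oo)%E),
   (forall g : R -> R, L2fun g ->
      (\int[P]_w (ip01 (shift_proc delta f 0 w) g)%:E)%E = 0%E) &
   (int01 (fun t => \int[P]_w ((shift_proc delta f 0 w t) ^+ 2)%:E) < +oo)%E ] ].

Definition sample_mean {d} {Om : measurableType d} {R : realType}
  (mu : R -> R) (eps : int -> Om -> R -> R) (N : nat) (w : Om) (t : R) : R :=
  (N%:R)^-1 * \sum_(1 <= i < N.+1) (mu t + eps i%:Z w t).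

(* Main.v *)
Require Import Defs.
From HB Require Import structures.
From mathcomp Require Import all_boot all_order all_algebra.
From mathcomp Require Import all_classical all_reals all_analysis.
From mathcomp Require Import measurable_realfun.
From mathcomp Require Import ring lra zify.
Import Order.TTheory GRing.Theory Num.Theory.
Import numFieldNormedType.Exports.
Local Open Scope classical_set_scope.
Local Open Scope ring_scope.
Set Implicit Arguments. Unset Strict Implicit. Unset Printing Implicit Defensive.

(** All processes are viewed in L^2 of Om x [0,1] with the product of P and the
    uniform law (functions of t are extended by 0 outside [0,1]).

    The finite cylinders form a pi-system, hence an i.i.d. family has a unique
    law, whatever probability space carries it. This gives the stationarity of
    (eps_i, eps_{i,m}), and shows that (eps_i, eps_{i+m,m}) is distributed as two
    independent copies of eps_0, realised on Om x Om; by Fubini and E eps_0 = 0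
    these two are orthogonal. So, with a_m := ||eps_0 - eps_{0,m}|| and
    s := ||eps_0||^2,
      2 |<eps_i, eps_{i+m}>| = 2 |<eps_i, eps_{i+m} - eps_{i+m,m}>| <= a_m (s + 1),
    and the summability of a_m yields ||eps_1 + ... + eps_N||^2 = O(N).

    If A := mu - mu' and B is the difference of the two error means, then
      | ||A + B||^2 - ||A||^2 | <= c ||A||^2 + (1 + 1/c) ||B||^2  for all c > 0,
    E ||B||^2 = O(1/N + 1/M), and Markov's inequality gives the first limit. The
    second one follows from NM/(N+M) >= min(N,M)/2. *)

(** * Laws of i.i.d. families *)

Section cylinder_space.
Context {dS dV : measure_display} (S : measurableType dS) (V : measurableType dV)
  (K : choiceType).

(** The factor [V] will carry the time variable, so that kernels jointly measurable in path and time
    can be integrated. Repetitions in [s] are harmless, as the constraint [A] depends on the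
    coordinate only. *)
Definition cylinders : set (set ((K -> S) * V)) :=
  [set C | exists (s : seq K) (A : K -> set S) (B : set V),
    [/\ forall k, measurable (A k), measurable B &
        C = [set p | (forall k, k \in s -> A k (p.1 k)) /\ B p.2]]].

Definition cylT := g_sigma_algebraType cylinders.

Lemma setI_closed_cylinders : setI_closed cylinders.
Proof.
move=> _ _ [s1 [A1 [B1 [mA1 mB1 ->]]]] [s2 [A2 [B2 [mA2 mB2 ->]]]].
(* Outside its own list, each cylinder is padded with [setT]. *)
exists (s1 ++ s2), (fun k => (if k \in s1 then A1 k else setT) `&`
  (if k \in s2 then A2 k else setT)), (B1 `&` B2); split.
- by move=> k; apply: measurableI; case: ifP.
- exact: measurableI.
- apply/seteqP; split=> p /=.
  + move=> [[h1 b1] [h2 b2]]; split => // k; rewrite mem_cat => _.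
    by split; case: ifPn => // ks; [exact: h1|exact: h2].
  + move=> [h [b1 b2]]; split; split => // k ks.
    * by have := h k; rewrite mem_cat ks /= => /(_ isT) [].
    * by have := h k; rewrite mem_cat ks orbT /= => /(_ isT) [].
Qed.

Lemma measurable_to_cylT (d : measure_display) (T : measurableType d)
    (X : T -> K -> S) (Y : T -> V) :
  (forall k, measurable_fun setT (X ^~ k)) -> measurable_fun setT Y ->
  measurable_fun setT (fun x => (X x, Y x) : cylT).
Proof.
move=> mX mY; apply: (@measurability _ _ _ cylT _ _ cylinders) => //.
move=> _ [_ [s [A [B [mA mB ->]]]] <-]; rewrite setTI.
have -> : (fun x => (X x, Y x) : cylT) @^-1`
    [set p | (forall k, k \in s -> A k (p.1 k)) /\ B p.2] =
    (\big[setI/setT]_(k <- s) ((X ^~ k) @^-1` A k)) `&` (Y @^-1` B).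
  rewrite -bigcap_seq; apply/seteqP; split => x [h ?]; split => // k; exact: h.
apply: measurableI; last by rewrite -(setTI (_ @^-1` _)); exact: mY.
apply: bigsetI_measurable => k _.
by rewrite -(setTI (_ @^-1` _)); exact: mX.
Qed.

Lemma measurable_cylT_fst (k : K) :
  measurable_fun setT (fun p : cylT => (p.1 k : S)).
Proof.
move=> _ A mA; rewrite setTI; apply: sub_sigma_algebra.
exists [:: k], (fun=> A), setT; split => //.
apply/seteqP; split => p /= => [pA|[] + _]; last by apply; rewrite inE.
by split=> // j; rewrite inE => /eqP ->.
Qed.

Lemma measurable_cylT_snd : measurable_fun setT (fun p : cylT => (p.2 : V)).
Proof.
move=> _ A mA; rewrite setTI; apply: sub_sigma_algebra.
exists [::], (fun=> setT), A; split => //.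
by apply/seteqP; split => p /= => [pA|[]//]; split.
Qed.

Section iid_law.
Context {R : realType} {d1 d2 : measure_display}
  (Om1 : measurableType d1) (Om2 : measurableType d2).
Variables (P1 : probability Om1 R) (P2 : probability Om2 R).
Variables (X1 : K -> Om1 -> S) (X2 : K -> Om2 -> S).
Variable (U : probability V R).
Hypotheses (iidX1 : iid P1 X1) (iidX2 : iid P2 X2).
Hypothesis eqX : forall k (A : set S), measurable A ->
  P1 (X1 k @^-1` A) = P2 (X2 k @^-1` A).

Let Phi1 (p : Om1 * V) : cylT := (X1 ^~ p.1, p.2).
Let Phi2 (p : Om2 * V) : cylT := (X2 ^~ p.1, p.2).

Let mPhi1 : measurable_fun setT Phi1.
Proof.
apply: measurable_to_cylT => // k.
by apply: measurableT_comp => //; exact: iidX1.1.1.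
Qed.

Let mPhi2 : measurable_fun setT Phi2.
Proof.
apply: measurable_to_cylT => // k.
by apply: measurableT_comp => //; exact: iidX2.1.1.
Qed.

(** On a cylinder, both image measures equal the product of the marginals times [U B]. The cylinders
    form a pi-system containing the whole space, which has finite mass, so two measures agreeing on
    them coincide. *)
Lemma iid_law_unique (C : set cylT) : measurable C ->
  pushforward (P1 \x U)%E Phi1 C = pushforward (P2 \x U)%E Phi2 C.
Proof.
have cyl (d : measure_display) (Om : measurableType d) (P : probability Om R)
    (X : K -> Om -> S) s A B : iid P X ->
    (forall k, measurable (A k)) -> measurable B ->
    (P \x U)%E ((fun p => (X ^~ p.1, p.2) : cylT) @^-1`
      [set p | (forall k, k \in s -> A k (p.1 k)) /\ B p.2]) =
    ((\prod_(k <- undup s) P (X k @^-1` A k)) * U B)%E.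
  (* [mutual_indep] factorises over duplicate-free lists; [undup] provides one without changing the
     intersection. *)
  move=> iidX mA mB; rewrite -iidX.1.2 ?undup_uniq// -product_measure1E//; last first.
    apply: bigsetI_measurable => k _.
    by rewrite -(setTI (_ @^-1` _)); exact: iidX.1.1.
  congr (product_measure1 _ _ _); rewrite -bigcap_seq.
  apply/seteqP; split => -[w t] /= [h ?]; split => // k.
    by rewrite /= mem_undup => ks; exact: h.
  by move=> ks; apply: h; rewrite /= mem_undup.
apply: (@measure_unique _ R cylT cylinders (fun=> setT)) => //.
- exact: setI_closed_cylinders.
- move=> _; exists [::], (fun=> setT), setT; split => //.
  by apply/seteqP; split => // p _; split.
- by rewrite bigcup_const.
- move=> _ [s [A [B [mA mB ->]]]]; rewrite /pushforward.
  rewrite [LHS](cyl _ _ P1)// [RHS](cyl _ _ P2)//.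
  by congr (_ * _)%E; apply: eq_bigr => k _; exact: eqX.
- move=> _ /=; rewrite /pushforward; rewrite preimage_setT -setXTT [ltLHS]product_measure1E//.
  apply: (@le_lt_trans _ _ (1 * 1)%E); last by rewrite mule1 ltry.
  by apply: lee_pmul => //; exact: probability_le1.
Qed.

End iid_law.
End cylinder_space.

(** * Transfer of integrals between i.i.d. families *)

Section iid_law_integral.
Context {dS dV : measure_display} (S : measurableType dS) (V : measurableType dV)
  (R : realType) (K : choiceType).
Context {d1 d2 : measure_display}
  (Om1 : measurableType d1) (Om2 : measurableType d2).
Variables (P1 : probability Om1 R) (P2 : probability Om2 R).
Variables (X1 : K -> Om1 -> S) (X2 : K -> Om2 -> S).
Variable (U : probability V R).
Hypotheses (iidX1 : iid P1 X1) (iidX2 : iid P2 X2).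
Hypothesis eqX : forall k (A : set S), measurable A ->
  P1 (X1 k @^-1` A) = P2 (X2 k @^-1` A).
Local Open Scope ereal_scope.

Lemma measurable_path (d : measure_display) (Om : measurableType d)
    (P : probability Om R) (X : K -> Om -> S) : iid P X ->
  measurable_fun setT (fun p : Om * V => (X ^~ p.1, p.2) : cylT S V K).
Proof.
move=> iidX; apply: measurable_to_cylT => // k.
by apply: measurableT_comp => //; exact: iidX.1.1.
Qed.

Lemma ge0_iid_integral (G : cylT S V K -> \bar R) : measurable_fun setT G ->
  (forall p, 0 <= G p) ->
  \int[P1 \x U]_p G (X1 ^~ p.1, p.2) = \int[P2 \x U]_p G (X2 ^~ p.1, p.2).
Proof.
move=> mG G0.
have := @ge0_integral_pushforward _ _ _ _ _ _ (measurable_path iidX1)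
  (P1 \x U) setT G measurableT mG (fun p _ => G0 p).
have := @ge0_integral_pushforward _ _ _ _ _ _ (measurable_path iidX2)
  (P2 \x U) setT G measurableT mG (fun p _ => G0 p).
rewrite !preimage_setT => <- <-; apply: eq_measure_integral => [||? ? C mC _].
- exact: measurable_path iidX2.
- exact: measurable_path iidX1.
- exact: iid_law_unique.
Qed.

(** The integral is by definition the difference of the integrals of the positive and negative
    parts, and each of these is transferred. *)
Lemma iid_integral (G : cylT S V K -> \bar R) : measurable_fun setT G ->
  \int[P1 \x U]_p G (X1 ^~ p.1, p.2) = \int[P2 \x U]_p G (X2 ^~ p.1, p.2).
Proof.
move=> mG; rewrite [LHS]integralE [RHS]integralE; congr (_ - _).
- have E := ge0_iid_integral (measurable_funepos mG) (funepos_ge0 G).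
  by apply: etrans (etrans E _); apply: eq_integral => p _; rewrite !funeposE.
- have E := ge0_iid_integral (measurable_funeneg mG) (funeneg_ge0 G).
  by apply: etrans (etrans E _); apply: eq_integral => p _; rewrite !funenegE.
Qed.

End iid_law_integral.

(** * Product probabilities and independent copies *)

Section product_probability.
Context {d1 d2 : measure_display} {Om1 : measurableType d1} {Om2 : measurableType d2}.
Context {R : realType} (P1 : probability Om1 R) (P2 : probability Om2 R).

Definition prod_prob : set (Om1 * Om2) -> \bar R := (P1 \x P2)%E.

HB.instance Definition _ := Measure.on prod_prob.

Let prod_prob_setT : prod_prob setT = 1%E.
Proof.
rewrite /prod_prob -setXTT [LHS]product_measure1E// -[RHS]mule1.
by congr (_ * _)%E; exact: probability_setT.
Qed.

HB.instance Definition _ :=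
  Measure_isProbability.Build _ _ _ prod_prob prod_prob_setT.

Lemma prod_probE (A : set Om1) (B : set Om2) : measurable A -> measurable B ->
  prod_prob (A `*` B) = (P1 A * P2 B)%E.
Proof. exact: product_measure1E. Qed.

End product_probability.

Section sum_family.
Context {dS : measure_display} (S : measurableType dS) (R : realType).
Context {d1 d2 : measure_display} (Om1 : measurableType d1) (Om2 : measurableType d2).
Variables (K1 K2 : choiceType) (P1 : probability Om1 R) (P2 : probability Om2 R).
Variables (X1 : K1 -> Om1 -> S) (X2 : K2 -> Om2 -> S).

(** Living on different factors makes the two families independent of each other; with [X1 = X2]
    this is a pair of independent copies. *)
Definition sum_family (k : K1 + K2) (w : Om1 * Om2) : S :=
  match k with inl k => X1 k w.1 | inr k => X2 k w.2 end.

Hypotheses (iidX1 : iid P1 X1) (iidX2 : iid P2 X2).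
Hypothesis eqX : forall k1 k2 (A : set S), measurable A ->
  P1 (X1 k1 @^-1` A) = P2 (X2 k2 @^-1` A).

Let Y := sum_family.
Let PP := prod_prob P1 P2.

Let mX1 k A : measurable A -> measurable (X1 k @^-1` A).
Proof. by move=> mA; rewrite -(setTI (_ @^-1` _)); exact: iidX1.1.1. Qed.

Let mX2 k A : measurable A -> measurable (X2 k @^-1` A).
Proof. by move=> mA; rewrite -(setTI (_ @^-1` _)); exact: iidX2.1.1. Qed.

Lemma marginal_sum_family_inl k A : measurable A ->
  PP (Y (inl k) @^-1` A) = P1 (X1 k @^-1` A).
Proof.
move=> mA; rewrite (_ : _ @^-1` _ = (X1 k @^-1` A) `*` setT); last first.
  by apply/seteqP; split=> -[? ?] //= [].
rewrite [LHS]prod_probE//; last exact: mX1.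
by rewrite -[RHS]mule1; congr (_ * _)%E; exact: probability_setT.
Qed.

Lemma marginal_sum_family_inr k A : measurable A ->
  PP (Y (inr k) @^-1` A) = P2 (X2 k @^-1` A).
Proof.
move=> mA; rewrite (_ : _ @^-1` _ = setT `*` (X2 k @^-1` A)); last first.
  by apply/seteqP; split=> -[? ?] //= [].
rewrite [LHS]prod_probE//; last exact: mX2.
by rewrite -[RHS]mul1e; congr (_ * _)%E; exact: probability_setT.
Qed.

Let lefts (s : seq (K1 + K2)) := pmap (fun k => if k is inl i then Some i else None) s.
Let rights (s : seq (K1 + K2)) := pmap (fun k => if k is inr i then Some i else None) s.

(** Splitting the index list into its left and right parts turns the event into a rectangle, whose
    probability factorises; each side is then handled by the independence of its own family. *)
Lemma iid_sum_family : iid PP Y.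
Proof.
split; [split|].
- move=> [k|k]; rewrite /Y /=.
    by apply: measurableT_comp => //; exact: iidX1.1.1.
  by apply: measurableT_comp => //; exact: iidX2.1.1.
- move=> s A us mA.
  have ul : uniq (lefts s).
    apply: (@pmap_uniq _ _ _ (inl : K1 -> K1 + K2)) => //.
    by move=> [] //.
  have ur : uniq (rights s).
    apply: (@pmap_uniq _ _ _ (inr : K2 -> K1 + K2)) => //.
    by move=> [] //.
  have -> : \big[setI/setT]_(i <- s) (Y i @^-1` A i) =
     (\big[setI/setT]_(i <- lefts s) (X1 i @^-1` A (inl i))) `*`
     (\big[setI/setT]_(i <- rights s) (X2 i @^-1` A (inr i))).
    elim: {us ul ur} s => [|[k|k] s IH] /=; first by rewrite !big_nil setXTT.
      by rewrite !big_cons IH; apply/seteqP; split=> -[? ?] /= => [[? []]|[[]]].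
    by rewrite !big_cons IH; apply/seteqP; split=> -[? ?] /= => [[? []]|[? []]].
  have -> : (\prod_(i <- s) PP (Y i @^-1` A i) =
     (\prod_(i <- lefts s) P1 (X1 i @^-1` A (inl i))) *
     (\prod_(i <- rights s) P2 (X2 i @^-1` A (inr i))))%E.
    elim: {us ul ur} s => [|[k|k] s IH] /=; first by rewrite !big_nil mule1.
      by rewrite !big_cons IH marginal_sum_family_inl// muleA.
    by rewrite !big_cons IH marginal_sum_family_inr// muleCA.
  rewrite [LHS]prod_probE; [|apply: bigsetI_measurable => i _; exact: mX1|
    apply: bigsetI_measurable => i _; exact: mX2].
  by rewrite iidX1.1.2// iidX2.1.2.
- move=> [i|i] [j|j] A mA.
  + by apply: etrans (marginal_sum_family_inl i mA)
      (etrans _ (esym (marginal_sum_family_inl j mA)));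
    exact: iidX1.2.
  + by apply: etrans (marginal_sum_family_inl i mA)
      (etrans _ (esym (marginal_sum_family_inr j mA)));
    exact: eqX.
  + by apply: etrans (marginal_sum_family_inr i mA)
      (etrans _ (esym (marginal_sum_family_inl j mA)));
    exact/esym/eqX.
  + by apply: etrans (marginal_sum_family_inr i mA)
      (etrans _ (esym (marginal_sum_family_inr j mA)));
    exact: iidX2.2.
Qed.

End sum_family.

(** This selects from a large family the innovations that a given process reads. Injectivity keeps
    duplicate-free lists duplicate-free. *)
Lemma iid_reindex (d dS : measure_display) (Om : measurableType d)
    (S : measurableType dS) (R : realType) (P : probability Om R)
    (I : eqType) (J : choiceType) (h : J -> I) (X : I -> Om -> S) :
  injective h -> iid P X -> iid P (X \o h).
Proof.
move=> hinj [[mX indX] idX]; split; [split|] => [i|s A us mA|i j A mA].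
- exact: mX.
(* [B] transports [A] along [h]: the preimage of an index is unique when it exists, and the other
   indices receive the trivial constraint. *)
- pose B i := if [pick j : seq_sub s | h (val j) == i] is Some j then A (val j) else setT.
  have BE j : j \in s -> B (h j) = A j.
    move=> js; rewrite /B; case: pickP => [k /eqP/hinj <- //|/(_ (SeqSub js))].
    by rewrite /= eqxx.
  have mB i : measurable (B i) by rewrite /B; case: pickP.
  have := indX (map h s) B; rewrite map_inj_uniq// => /(_ us mB).
  rewrite !big_map => E.
  transitivity (P (\big[setI/setT]_(j <- s) (X (h j) @^-1` B (h j)))).
    by congr (P _); rewrite !big_seq; apply: eq_bigr => j js; rewrite BE.
  by rewrite E !big_seq; apply: eq_bigr => j js; rewrite BE.
- exact: idX.
Qed.

(** * Square-integrable functions *)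

Section square_integrable.
Context {d : measure_display} {T : measurableType d} {R : realType}.
Variable mu : {measure set T -> \bar R}.

Definition sqint (x : T -> R) :=
  measurable_fun setT x /\ (\int[mu]_z ((x z) ^+ 2)%:E < +oo)%E.

Definition ipL2 (x y : T -> R) : R := \int[mu]_z (x z * y z).

Lemma integrable_sq x : sqint x -> mu.-integrable setT (fun z => ((x z) ^+ 2)%:E).
Proof.
move=> [mx xoo]; apply/integrableP; split.
  by apply/measurable_EFinP; exact: measurable_funX.
apply: le_lt_trans xoo; apply: ge0_le_integral => //.
- apply: measurableT_comp => //; apply/measurable_EFinP; exact: measurable_funX.
- by apply/measurable_EFinP; exact: measurable_funX.
- by move=> z _; rewrite gee0_abs// lee_fin sqr_ge0.
Qed.

(** The product is dominated by [x ^+ 2 + y ^+ 2]. *)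
Lemma integrable_sqintM x y : sqint x -> sqint y ->
  mu.-integrable setT (EFin \o (fun z => x z * y z)).
Proof.
move=> sx sy.
apply: (le_integrable measurableT _ _
  (integrableD measurableT (integrable_sq sx) (integrable_sq sy))).
  by apply/measurable_EFinP; apply: measurable_funM; [exact: sx.1|exact: sy.1].
move=> z _ /=; rewrite lee_fin.
rewrite [leRHS]ger0_norm ?addr_ge0 ?sqr_ge0// ler_norml.
by apply/andP; split; nra.
Qed.

Lemma sqint0 : sqint (fun=> 0).
Proof. by split => //; under eq_integral do rewrite expr0n; rewrite integral0. Qed.

Lemma sqintD x y : sqint x -> sqint y -> sqint (fun z => x z + y z).
Proof.
move=> sx sy; split; first by apply: measurable_funD; [exact: sx.1|exact: sy.1].
have isq : mu.-integrable setT (EFin \o (fun z => (x z + y z) ^+ 2)).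
  have ixy := integrable_sqintM sx sy.
  have := integrableD measurableT (integrableD measurableT (integrable_sq sx)
    (integrable_sq sy)) (integrableD measurableT ixy ixy).
  by congr (integrable _ _ _); apply/funext => z /=; rewrite -!EFinD; congr EFin; ring.
move/integrableP : isq => [_]; apply: le_lt_trans.
rewrite le_eqVlt; apply/orP; left; apply/eqP/eq_integral => z _ /=.
by rewrite ger0_norm ?sqr_ge0.
Qed.

Lemma sqintZ c x : sqint x -> sqint (fun z => c * x z).
Proof.
move=> sx; split; first by apply: measurable_funM => //; exact: sx.1.
under eq_integral do rewrite exprMn EFinM.
rewrite ge0_integralZl//.
- by apply: lte_mul_pinfty; [rewrite lee_fin sqr_ge0|rewrite fin_numE|exact: sx.2].
- by apply/measurable_EFinP; apply: measurable_funX; exact: sx.1.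
- by move=> z _; rewrite lee_fin sqr_ge0.
- by rewrite lee_fin sqr_ge0.
Qed.

Lemma sqintB x y : sqint x -> sqint y -> sqint (fun z => x z - y z).
Proof.
move=> sx sy; rewrite (_ : (fun z => _) = (fun z => x z + (- 1) * y z)).
  by apply: sqintD => //; exact: sqintZ.
by apply/funext => z; rewrite mulN1r.
Qed.

Lemma sqint_sum (I : Type) (s : seq I) (x : I -> T -> R) :
  (forall i, sqint (x i)) -> sqint (fun z => \sum_(i <- s) x i z).
Proof.
move=> sx; elim: s => [|i s IH].
  by under eq_fun do rewrite big_nil; exact: sqint0.
by under eq_fun do rewrite big_cons; exact: sqintD.
Qed.

Lemma ipL2C x y : ipL2 x y = ipL2 y x.
Proof. by apply: eq_Rintegral => z _; rewrite mulrC. Qed.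

Lemma ipL2Dl x y z : sqint x -> sqint y -> sqint z ->
  ipL2 (fun t => x t + y t) z = ipL2 x z + ipL2 y z.
Proof.
move=> sx sy sz; rewrite /ipL2 -RintegralD//; try exact: integrable_sqintM.
by apply: eq_Rintegral => t _; rewrite mulrDl.
Qed.

Lemma ipL2Zl c x z : sqint x -> sqint z ->
  ipL2 (fun t => c * x t) z = c * ipL2 x z.
Proof.
move=> sx sz; rewrite /ipL2 -RintegralZl//; try exact: integrable_sqintM.
by apply: eq_Rintegral => t _; rewrite mulrA.
Qed.

Lemma ipL2_ge0 x : 0 <= ipL2 x x.
Proof. by apply: Rintegral_ge0 => z _; rewrite -expr2 sqr_ge0. Qed.

Lemma ipL2_sqD x y : sqint x -> sqint y ->
  ipL2 (fun t => x t + y t) (fun t => x t + y t) =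
  ipL2 x x + 2 * ipL2 x y + ipL2 y y.
Proof.
move=> sx sy; have sxy := sqintD sx sy.
rewrite ipL2Dl// (ipL2C x) (ipL2C y) !ipL2Dl// (ipL2C y x); ring.
Qed.

(** Expand the square norm of [- (e * c) * x + y], which is non-negative, and divide by [c]; the two
    signs [e = 1] and [e = - 1] give the absolute value. *)
Lemma ipL2_amgm c x y : 0 < c -> sqint x -> sqint y ->
  2 * `|ipL2 x y| <= c * ipL2 x x + c^-1 * ipL2 y y.
Proof.
move=> c0 sx sy.
have main e : e ^+ 2 = 1 -> 2 * (e * ipL2 x y) <= c * ipL2 x x + c^-1 * ipL2 y y.
  move=> e1; have := ipL2_ge0 (fun t => - (e * c) * x t + y t).
  have scx := sqintZ (- (e * c)) sx.
  rewrite ipL2_sqD// !ipL2Zl// (ipL2C x) ipL2Zl//.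
  rewrite (_ : - (e * c) * (- (e * c) * ipL2 x x) = c ^+ 2 * ipL2 x x); last first.
    by transitivity (e ^+ 2 * (c ^+ 2 * ipL2 x x)); [ring|rewrite e1 mul1r].
  move=> h; rewrite -(ler_pM2l c0) mulrDr mulrA [X in _ <= _ + X]mulrA divff ?gt_eqF// mul1r.
  by nra.
case: (ger0P (ipL2 x y)) => _.
  by have := main 1; rewrite expr1n mul1r; apply.
by have := main (- 1); rewrite sqrrN expr1n mulN1r; apply.
Qed.

Lemma ipL2_suml (I : Type) (s : seq I) (x : I -> T -> R) y :
  (forall i, sqint (x i)) -> sqint y ->
  ipL2 (fun z => \sum_(i <- s) x i z) y = \sum_(i <- s) ipL2 (x i) y.
Proof.
move=> sx sy; elim: s => [|i s IH].
  rewrite big_nil (_ : (fun z => _) = (fun z => 0 * 0)); last first.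
    by apply/funext => z; rewrite big_nil mul0r.
  by rewrite ipL2Zl ?mul0r//; exact: sqint0.
rewrite big_cons -IH -ipL2Dl//; last exact: sqint_sum.
by congr ipL2; apply/funext => z; rewrite big_cons.
Qed.

(** By induction on [N]: a new term adds [s] plus twice its inner products with the earlier ones,
    and these, sorted by lag, are bounded by a partial sum of [g]. *)
Lemma ipL2_sum_le (x : nat -> T -> R) (s C : R) (g : nat -> R) :
  (forall i, sqint (x i)) -> (forall i, ipL2 (x i) (x i) = s) ->
  (forall i k, 2 * `|ipL2 (x i) (x (i + k).+1)| <= g k) ->
  (forall n, \sum_(k < n) g k <= C) ->
  forall N, ipL2 (fun z => \sum_(i < N) x i z) (fun z => \sum_(i < N) x i z)
    <= N%:R * (s + C).
Proof.
move=> sx xs xg gC; elim=> [|N IH].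
  rewrite (_ : (fun z => _) = (fun z => 0 * 0)); last first.
    by apply/funext => z; rewrite big_ord0 mul0r.
  by rewrite ipL2Zl ?mul0r//; exact: sqint0.
have sS : sqint (fun z => \sum_(i < N) x i z) by exact: sqint_sum.
rewrite (_ : (fun z => _) = (fun z => (\sum_(i < N) x i z) + x N z)); last first.
  by apply/funext => z; rewrite big_ord_recr.
rewrite ipL2_sqD// xs (ipL2_suml _ _ (sx N))//.
suff : 2 * (\sum_(i < N) ipL2 (x i) (x N)) <= C.
  by move=> h; rewrite -natr1 mulrDl mul1r; lra.
(* Reversing the order makes the summation index [i] stand for the lag [i.+1]. *)
apply: le_trans (gC N); rewrite mulr_sumr (reindex_inj rev_ord_inj)/=.
apply: ler_sum => i _.
apply: le_trans (xg (N - i.+1)%N i).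
rewrite (_ : (N - i.+1 + i).+1 = N); last by have := ltn_ord i; lia.
by rewrite ler_pM2l// ler_norm.
Qed.

End square_integrable.

(** * Functions on the unit interval *)

Section unit_interval.
Context {R : realType}.

Let U : probability (measurableTypeR R) R := uniform_prob (@ltr01 R).

Definition restr01 (g : R -> R) : R -> R := g \_ `[(0:R), (1:R)].

Lemma restr01_in g t : t \in `[(0:R), (1:R)] -> restr01 g t = g t.
Proof. by move=> tI; rewrite /restr01 patchE mem_setE tI. Qed.

Lemma restr01_out g t : t \notin `[(0:R), (1:R)] -> restr01 g t = 0.
Proof. by move=> tI; rewrite /restr01 patchE mem_setE (negbTE tI). Qed.

Lemma measurable_restr01 g : measurable_fun `[(0:R), (1:R)] g ->
  measurable_fun setT (restr01 g).
Proof. by move=> mg; apply/(measurable_restrictT g). Qed.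

(** The uniform density on the unit interval is 1; the formula for non-negative integrands is
    applied to both parts of [h]. *)
Lemma int01_uniform (h : R -> R) : measurable_fun setT h ->
  int01 (fun t => (h t)%:E) = (\int[U]_t (h t)%:E)%E.
Proof.
move=> /measurable_EFinP mh; rewrite /int01 [LHS]integralE [RHS]integralE.
rewrite !integral_uniform//; last 2 first.
  exact: measurable_funeneg.
  exact: measurable_funepos.
by rewrite subr0 invr1 !mul1e.
Qed.

Lemma eq_int01 (h1 h2 : R -> R) : {in `[(0:R), (1:R)], h1 =1 h2} ->
  int01 (fun t => (h1 t)%:E) = int01 (fun t => (h2 t)%:E).
Proof.
by move=> h12; apply: eq_integral => t; rewrite mem_setE => tI; rewrite h12.
Qed.

Lemma sqint_restr01 g : L2fun g -> sqint U (restr01 g).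
Proof.
move=> [mg goo]; have mr := measurable_restr01 mg; split => //.
rewrite -int01_uniform; last exact: measurable_funX.
by rewrite (eq_int01 (h2 := fun t => g t ^+ 2))// => t tI; rewrite restr01_in.
Qed.

Lemma ip01E g h : L2fun g -> L2fun h -> ip01 g h = ipL2 U (restr01 g) (restr01 h).
Proof.
move=> [mg _] [mh _]; rewrite /ip01 /ipL2 /Rintegral -int01_uniform.
  by congr fine; apply: eq_int01 => t tI; rewrite !restr01_in.
by apply: measurable_funM; exact: measurable_restr01.
Qed.

End unit_interval.

Lemma integral_sqE (d : measure_display) (T : measurableType d) (R : realType)
    (mu : {measure set T -> \bar R}) (x : T -> R) : sqint mu x ->
  (\int[mu]_z ((x z) ^+ 2)%:E)%E = (ipL2 mu x x)%:E.
Proof.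
move=> sx; rewrite /ipL2 /Rintegral fineK; first exact: eq_integral.
apply: integrable_fin_num => //; exact: integrable_sqintM.
Qed.

(** * Joint measurability of the shift kernel *)

Section restricted_kernel.
Context {dS : measure_display} {S : measurableType dS} {R : realType}.
Variable f : (nat -> S) -> R -> R.
Hypothesis mf : shift_measurable f.

Definition ker01 (p : (nat -> S) * R) : R := restr01 (f p.1) p.2.

(** A preimage is split according to the time. Inside the unit interval it is given by
    [shift_measurable], whose generators are measurable for [cylinders]; outside, the value is 0, so
    it is all or nothing according to [B 0]. *)
Lemma measurable_ker01 : measurable_fun setT (ker01 : cylT S (measurableTypeR R) nat -> R).
Proof.
have sub : <<s @cyl_rect _ S R >> `<=` <<s @cylinders _ _ S (measurableTypeR R) nat >>.
  apply: smallest_sub; first exact: smallest_sigma_algebra.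
  move=> _ [k [A [B [mA [mB ->]]]]].
  apply: (@measurableI _ (cylT S (measurableTypeR R) nat)).
    by rewrite -(setTI (_ @^-1` _)); exact: measurable_cylT_fst.
  by rewrite -(setTI (_ @^-1` _)); exact: measurable_cylT_snd.
have mI : measurable
    ([set p | p.2 \in `[(0:R), (1:R)]] : set (cylT S (measurableTypeR R) nat)).
  rewrite (_ : [set p | _] =
    (fun p : cylT S (measurableTypeR R) nat => p.2 : measurableTypeR R) @^-1` `[(0:R), (1:R)]).
    by rewrite -(setTI (_ @^-1` _)); exact: measurable_cylT_snd.
  by apply/seteqP; split => p /=.
move=> _ B mB; rewrite setTI.
rewrite (_ : _ @^-1` _ = ([set p | p.2 \in `[(0:R), (1:R)]] `&` (fun p => f p.1 p.2) @^-1` B)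
  `|` (~` [set p | p.2 \in `[(0:R), (1:R)]] `&` [set p | B 0])).
  apply: measurableU; first by apply: sub; exact: mf.1.
  apply: measurableI; first exact: measurableC.
  have [B0|B0] := pselect (B 0).
    by rewrite (_ : [set p | _] = setT)//; apply/seteqP; split.
  by rewrite (_ : [set p | _] = set0)//; apply/seteqP; split.
apply/seteqP; split => p /=; rewrite /ker01.
  case: (boolP (p.2 \in `[(0:R), (1:R)])) => pI.
    by rewrite restr01_in// => ?; left.
  by rewrite restr01_out// => ?; right; split => //; apply/negP.
move=> [[pI]|[/negP pI]]; first by rewrite restr01_in.
by rewrite restr01_out.
Qed.

(** With [K := nat + nat], this lets two kernels read different coordinates of one common path. *)
Lemma measurable_ker01_reindex (K : choiceType) (h : nat -> K) :
  measurable_fun setT (fun p : cylT S (measurableTypeR R) K =>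
    ker01 (fun k => p.1 (h k), p.2)).
Proof.
apply: (measurableT_comp measurable_ker01).
apply: measurable_to_cylT => [k|]; first exact: measurable_cylT_fst.
exact: measurable_cylT_snd.
Qed.

End restricted_kernel.

(** * The error process *)

(** Take [c := Num.sqrt a]. The result is a weak Cauchy-Schwarz bound, linear in [Num.sqrt a], the
    quantity assumed summable. *)
Lemma le_sqrt_of_amgm (R : realType) (I s a : R) : 0 <= s -> 0 <= a ->
  (forall c, 0 < c -> I <= c * s + c^-1 * a) -> I <= Num.sqrt a * (s + 1).
Proof.
move=> s0 a0 H; have s1 : 0 < s + 1 by rewrite ltr_wpDl.
have [sa0|sa0] := ltrP 0 (Num.sqrt a).
  apply: le_trans (H _ sa0) _.
  rewrite (_ : _^-1 * a = Num.sqrt a) ?mulrDr ?mulr1//.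
  by rewrite -[X in _ * X](sqr_sqrtr a0) expr2 mulrA mulVf ?gt_eqF// mul1r.
have -> : Num.sqrt a = 0 by apply/eqP; rewrite eq_le sa0 sqrtr_ge0.
have a00 : a = 0 by rewrite -(sqr_sqrtr a0); apply/eqP; rewrite sqrf_eq0 eq_le sa0 sqrtr_ge0.
rewrite mul0r leNgt; apply/negP => I0.
(* For [a = 0] the optimal [c] degenerates; this one would give [I <= I * s / (s + 1)], impossible
   for [I > 0]. *)
have := H (I / (s + 1)) (divr_gt0 I0 s1); rewrite a00 mulr0 addr0.
by rewrite -mulrA ler_pMr// mulrC ler_pdivlMr// mul1r; lra.
Qed.

Section error_process.
Context {d dS : measure_display} {Om : measurableType d} {S : measurableType dS}
  {R : realType} (P : probability Om R) (delta : int -> Om -> S)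
  (deltac : nat -> int -> int -> Om -> S) (f : (nat -> S) -> R -> R).
Hypothesis EA : error_assumptions P delta deltac f.

Let V := measurableTypeR R.
Let lam : probability V R := uniform_prob (@ltr01 R).
Let Q : {measure set (Om * V)%type -> \bar R} := (P \x lam)%E.

Let mf : shift_measurable f. Proof. by case: EA. Qed.

Let coupled (m : nat) (i : int) (k : int + int) : Om -> S :=
  match k with inl k => delta k | inr k => deltac m i k end.

Let iid_delta : iid P delta. Proof. by case: EA. Qed.

Let iid_coupled m i : (0 < m)%N -> iid P (coupled m i).
Proof. by case: EA => _ + _ _ => /(_ m i). Qed.

Let coupled_marginal m i a A : (0 < m)%N -> measurable A ->
  P (coupled m i a @^-1` A) = P (delta 0 @^-1` A).
Proof. by move=> m0 mA; apply: ((iid_coupled i m0).2 a (inl 0)). Qed.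

Definition err01 (i : int) (p : Om * V) : R :=
  restr01 (shift_proc delta f i p.1) p.2.

Definition err01m (m : nat) (i : int) (p : Om * V) : R :=
  restr01 (shift_proc_m delta deltac f m i p.1) p.2.

Let past (i : int) (k : nat) : int := i - k%:Z.

Let past_inj i : injective (past i).
Proof. by move=> a b; rewrite /past; lia. Qed.

(** The indices read by eps_{i,m} in the joint family [coupled m i]. *)
Let cut m i k : int + int := if (k < m)%N then inl (past i k) else inr (past i k).

Let cut_inj m i : injective (cut m i).
Proof.
by move=> a b; rewrite /cut; case: ifP => ?; case: ifP => ? // -[] /past_inj.
Qed.

Let base k : Om -> S := delta (past 0 k).

Let iid_base : iid P base.
Proof. exact: (iid_reindex (@past_inj 0) iid_delta). Qed.

Let base_marginal k A : measurable A -> P (base k @^-1` A) = P (delta 0 @^-1` A).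
Proof. by move=> mA; apply: iid_delta.2. Qed.

Let proc (X : nat -> Om -> S) (p : Om * V) : R := ker01 f (X ^~ p.1, p.2).

Let measurable_proc X : iid P X -> measurable_fun setT (proc X).
Proof.
move=> iidX; apply: (measurableT_comp (measurable_ker01 mf)).
exact: measurable_path iidX.
Qed.

Let sqint_base : sqint Q (proc base).
Proof.
have m2 : measurable_fun setT (fun p : Om * V => ((proc base p) ^+ 2)%:E).
  by apply/measurable_EFinP/measurable_funX; exact: measurable_proc.
split; first exact: measurable_proc.
(* The second-moment hypothesis integrates over [Om] first and over time afterwards. *)
rewrite [ltLHS]fubini_tonelli2//; last by move=> p; rewrite lee_fin sqr_ge0.
case: EA => _ _ _ [_ _]; apply: le_lt_trans.
rewrite integral_uniform; last 2 first.
  apply: measurable_fun_fubini_tonelli_G => // p; by rewrite lee_fin sqr_ge0.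
  by move=> t; apply: integral_ge0 => w _; rewrite lee_fin sqr_ge0.
rewrite subr0 invr1 mul1e /int01 le_eqVlt; apply/orP; left; apply/eqP.
apply: eq_integral => t; rewrite mem_setE => tI; apply: eq_integral => w _.
by rewrite /proc /ker01 restr01_in.
Qed.

Let s := ipL2 Q (proc base) (proc base).

(** Such a family has the law of [base], so the process it drives has the law of eps_0; this covers
    every eps_i and every eps_{i,m}. *)
Let same_law (X : nat -> Om -> S) : iid P X ->
  (forall k A, measurable A -> P (X k @^-1` A) = P (delta 0 @^-1` A)) ->
  sqint Q (proc X) /\ ipL2 Q (proc X) (proc X) = s.
Proof.
move=> iidX XE.
have E : (\int[Q]_p ((proc X p) ^+ 2)%:E = \int[Q]_p ((proc base p) ^+ 2)%:E)%E.
  apply: (@ge0_iid_integral _ _ S V R nat _ _ Om Om P P X base lam iidX iid_base _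
    (fun p => ((ker01 f p) ^+ 2)%:E)).
  - by move=> k A mA; rewrite XE// base_marginal.
  - by apply/measurable_EFinP/measurable_funX; exact: measurable_ker01.
  - by move=> p; rewrite lee_fin sqr_ge0.
have sX : sqint Q (proc X).
  by split; [exact: measurable_proc|rewrite E; exact: sqint_base.2].
split => //; have := E; rewrite integral_sqE// integral_sqE; last exact: sqint_base.
by case.
Qed.

Let err_law i : sqint Q (err01 i) /\ ipL2 Q (err01 i) (err01 i) = s.
Proof.
apply: (@same_law (fun k => delta (past i k))).
  exact: (iid_reindex (@past_inj i) iid_delta).
by move=> k A mA; apply: iid_delta.2.
Qed.

Lemma sqint_err01 i : sqint Q (err01 i). Proof. by case: (err_law i). Qed.

Let err01mE m i : err01m m i = proc (fun k => coupled m i (cut m i k)).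
Proof.
apply/funext => -[w t]; rewrite /err01m /proc /ker01 /shift_proc_m /=.
by congr restr01; congr f; apply/funext => k; rewrite /cut; case: ifP.
Qed.

Let sqint_err01m m i : (0 < m)%N -> sqint Q (err01m m i).
Proof.
move=> m0; rewrite err01mE; apply: (proj1 (same_law _ _)).
  exact: (iid_reindex (@cut_inj m i) (iid_coupled i m0)).
by move=> k A mA; exact: coupled_marginal.
Qed.

(** This is the square of the approximation error: a_m is [Num.sqrt (gap m 0)]. *)
Let gap m i := ipL2 Q (fun p => err01 i p - err01m m i p) (fun p => err01 i p - err01m m i p).

Let sqint_gap m i : (0 < m)%N -> sqint Q (fun p => err01 i p - err01m m i p).
Proof. by move=> m0; apply: sqintB; [exact: sqint_err01|exact: sqint_err01m]. Qed.

Let both (i : int) (k : nat + nat) : int + int :=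
  match k with inl k => inl (past i k) | inr k => inr (past i k) end.

Let both_inj i : injective (both i).
Proof. by move=> [a|a] [b|b] //= -[] /past_inj ->. Qed.

(** For every [i], the squared difference is the same function [G] of an i.i.d. family over
    [nat + nat], whose marginals do not depend on [i]. *)
Let gap_stationary m i : (0 < m)%N -> gap m i = gap m 0.
Proof.
move=> m0.
pose h k : nat + nat := if (k < m)%N then inl k else inr k.
pose G (p : cylT S V (nat + nat)%type) : \bar R :=
  ((ker01 f (fun k => p.1 (inl k), p.2) - ker01 f (fun k => p.1 (h k), p.2)) ^+ 2)%:E.
have GE j p : ((err01 j p - err01m m j p) ^+ 2)%:E =
    G ((fun k => coupled m j (both j k)) ^~ p.1, p.2).
  rewrite /G err01mE /proc /err01 /ker01 /=.
  congr (((_ - restr01 (f _) _) ^+ 2)%:E); apply/funext => k.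
  by rewrite /cut /h; case: ifP.
have E : (\int[Q]_p ((err01 i p - err01m m i p) ^+ 2)%:E =
    \int[Q]_p ((err01 0 p - err01m m 0 p) ^+ 2)%:E)%E.
  under eq_integral do rewrite GE.
  under [RHS]eq_integral do rewrite GE.
  apply: (@ge0_iid_integral _ _ S V R _ _ _ Om Om P P _ _ lam
    (iid_reindex (@both_inj i) (iid_coupled i m0))
    (iid_reindex (@both_inj 0) (iid_coupled 0 m0)) _ G).
  - by move=> k A mA; rewrite !coupled_marginal.
  - apply/measurable_EFinP/measurable_funX/measurable_funB;
    exact: measurable_ker01_reindex.
  - by move=> p; rewrite lee_fin sqr_ge0.
by move: E; rewrite !integral_sqE; [case|exact: sqint_gap|exact: sqint_gap].
Qed.

(* (err01 i, err01m m (i + m)) has the law of (e, e') on Om x Om, with e and e'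
   independent copies of err01 0: the kept innovations of err01m m (i + m) have
   indices in ]i, i + m]. *)
Let err01_err01m_orth m i : (0 < m)%N ->
  ipL2 Q (err01 i) (err01m m (i + m%:Z)) = 0.
Proof.
move=> m0; set j := i + m%:Z.
pose h (k : nat + nat) : int + int :=
  match k with inl k => inl (past i k) | inr k => cut m j k end.
(* Disjointness of the innovations read by the two processes takes the form of injectivity of [h];
   clashes are possible only between two [inl] indices. *)
have h_inj : injective h.
  move=> [a|a] [b|b] //=; rewrite /cut.
  - by move=> [] /past_inj ->.
  - by case: ifP => // bm []; rewrite /past /j; lia.
  - by case: ifP => // bm []; rewrite /past /j; lia.
  - by move=> /(@cut_inj m j) ->.
have iidZ := iid_reindex h_inj (iid_coupled j m0).
set Z := coupled m j \o h in iidZ.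
have ZE k A : measurable A -> P (Z k @^-1` A) = P (delta 0 @^-1` A).
  exact: coupled_marginal.
pose PP := prod_prob P P.
pose Y := sum_family base base.
have iidY : iid PP Y.
  by apply: iid_sum_family => // k1 k2 A mA; rewrite !base_marginal.
have ZY k A : measurable A -> P (Z k @^-1` A) = PP (Y k @^-1` A).
  move=> mA; rewrite ZE// -(base_marginal 0)//.
  have -> : P (base 0 @^-1` A) = PP (Y (inl 0%N) @^-1` A).
    exact/esym/marginal_sum_family_inl.
  exact: iidY.2.
pose kl (p : cylT S V (nat + nat)%type) : R := ker01 f (fun k => p.1 (inl k), p.2).
pose kr (p : cylT S V (nat + nat)%type) : R := ker01 f (fun k => p.1 (inr k), p.2).
have mkl : measurable_fun setT kl by exact: measurable_ker01_reindex.
have mkr : measurable_fun setT kr by exact: measurable_ker01_reindex.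
pose QQ : {measure set (Om * Om * V)%type -> \bar R} := (PP \x lam)%E.
pose xl (p : Om * Om * V) := kl (Y ^~ p.1, p.2).
pose xr (p : Om * Om * V) := kr (Y ^~ p.1, p.2).
have sq_transfer (g : cylT S V (nat + nat)%type -> R) : measurable_fun setT g ->
    sqint Q (fun p => g (Z ^~ p.1, p.2)) -> sqint QQ (fun p => g (Y ^~ p.1, p.2)).
  move=> mg [_ goo]; split.
    exact: (measurableT_comp mg (measurable_path iidY)).
  suff <- : (\int[Q]_p ((g (Z ^~ p.1, p.2)) ^+ 2)%:E =
     \int[QQ]_p ((g (Y ^~ p.1, p.2)) ^+ 2)%:E)%E by [].
  apply: (@ge0_iid_integral _ _ S V R _ _ _ Om _ P PP Z Y lam iidZ iidY ZY
    (fun p => ((g p) ^+ 2)%:E)).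
    by apply/measurable_EFinP/measurable_funX.
  by move=> p; rewrite lee_fin sqr_ge0.
have sl : sqint QQ xl by apply: sq_transfer => //; exact: sqint_err01.
have sr : sqint QQ xr.
  apply: sq_transfer => //.
  by have := sqint_err01m j m0; rewrite err01mE.
have ixy := integrable_sqintM sl sr.
have L2e w : L2fun (shift_proc delta f 0 w) by exact: mf.2.
rewrite /ipL2 /Rintegral (_ : integral _ _ _ = 0%E)//.
transitivity (\int[QQ]_p (xl p * xr p)%:E)%E.
  transitivity (\int[Q]_p (kl (Z ^~ p.1, p.2) * kr (Z ^~ p.1, p.2))%:E)%E.
    by apply: eq_integral => p _; rewrite err01mE.
  apply: (@iid_integral _ _ S V R _ _ _ Om _ P PP Z Y lam iidZ iidY ZY
    (fun p => (kl p * kr p)%:E)).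
  by apply/measurable_EFinP/measurable_funM.
(* After integrating out the time, what remains is the inner product of two independent copies of
   eps_0. *)
pose F (w : Om * Om) : \bar R :=
  (ip01 (shift_proc delta f 0 w.1) (shift_proc delta f 0 w.2))%:E.
have FE : fubini_F lam (EFin \o (fun p => xl p * xr p)) = F.
  apply/funext => w; rewrite /fubini_F /F ip01E//.
  rewrite /ipL2 /Rintegral fineK//.
  apply: integrable_fin_num => //.
  by apply: integrable_sqintM; exact: sqint_restr01.
have iF := integrable_fubini_F ixy; rewrite FE in iF.
rewrite -[LHS](integral12_prod_meas1 ixy) FE.
(* With the second outcome frozen, its path is a fixed L^2 function, against which eps_0 has mean
   zero. *)
rewrite -[LHS](@integral21_prod_meas1 _ _ _ _ _ P P _ iF).
rewrite integral0_eq// => w2 _; rewrite /fubini_G /F /=.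
by case: EA => _ _ _ [_ + _]; apply.
Qed.

(** The truncation level equals the lag, so that the truncated variable is orthogonal to [err01 i]
    and only the difference [D] contributes. *)
Let err01_cov_le i k :
  2 * `|ipL2 Q (err01 i) (err01 (i + k.+1%:Z))| <= Num.sqrt (gap k.+1 0) * (s + 1).
Proof.
set j := i + k.+1%:Z.
have := sqint_gap j (ltn0Sn k); set D := (fun p => _ - _) => sD.
have -> : ipL2 Q (err01 i) (err01 j) = ipL2 Q (err01 i) D.
  rewrite (_ : err01 j = fun p => D p + err01m k.+1 j p); last first.
    by apply/funext => p; rewrite /D subrK.
  rewrite ipL2C ipL2Dl//; [|exact: sqint_err01m|exact: sqint_err01].
  by rewrite (ipL2C _ (err01m _ _)) err01_err01m_orth// addr0 ipL2C.
have s0 : 0 <= s by exact: ipL2_ge0.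
apply: le_sqrt_of_amgm => //; first exact: ipL2_ge0.
move=> c c0; have := ipL2_amgm c0 (sqint_err01 i) sD.
rewrite (proj2 (err_law i)) -/(gap k.+1 j) gap_stationary//.
Qed.

Let sum_gap : exists C, forall n, \sum_(k < n) Num.sqrt (gap k.+1 0) <= C.
Proof.
case: EA => _ _ _ [/(_ 0) + _ _].
set u := (u in (\sum_(1 <= m <oo) u m)%E) => uoo.
have u0 m : (0 <= u m)%E by exact: sqrte_ge0.
(* Tonelli identifies the iterated integral of the hypothesis with the norm over the product
   space. *)
have uE k : u k.+1 = (Num.sqrt (gap k.+1 0))%:E.
  rewrite /u -[RHS]/(sqrte (gap k.+1 0)%:E); congr sqrte.
  rewrite -integral_sqE; last exact: sqint_gap.
  have sg := sqint_gap 0 (ltn0Sn k).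
  rewrite [RHS]fubini_tonelli1//; last 2 first.
    by apply/measurable_EFinP/measurable_funX; exact: sg.1.
    by move=> p; rewrite lee_fin sqr_ge0.
  apply: eq_integral => w _; rewrite /fubini_F -int01_uniform; last first.
    apply/measurable_funX/(measurableT_comp sg.1).
    exact: measurable_pair1.
  by apply: eq_int01 => t tI; rewrite /err01 /err01m !restr01_in.
exists (fine (\sum_(1 <= m <oo) u m)%E) => n.
rewrite -lee_fin fineK; last first.
  by rewrite ge0_fin_numE//; apply: nneseries_ge0 => m _ _; exact: u0.
(* The series starts at 1, so its [n] first terms are those below [n.+1]. *)
apply: le_trans (nneseries_lim_ge n.+1 (fun m _ _ => u0 m)).
rewrite big_add1 /= big_mkord -sumEFin.
by apply: lee_sum => k _; rewrite uE.
Qed.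

(** The covariance bounds are summable in the lag, so [ipL2_sum_le] applies; the shift [i.+1]
    matches samples numbered from 1. *)
Lemma err01_sum_le : exists C, forall N,
  ipL2 Q (fun p => \sum_(i < N) err01 i.+1%:Z p) (fun p => \sum_(i < N) err01 i.+1%:Z p)
    <= N%:R * C.
Proof.
have [C gC] := sum_gap; exists (s + C * (s + 1)).
apply: (@ipL2_sum_le _ _ _ _ (fun i => err01 i.+1%:Z) s _
  (fun k => Num.sqrt (gap k.+1 0) * (s + 1))) => [i|i|i k|n].
- exact: sqint_err01.
- exact: (proj2 (err_law _)).
- by have := err01_cov_le i.+1%:Z k; rewrite (_ : i.+1%:Z + _ = (i + k).+2%:Z)//; lia.
- rewrite -mulr_suml ler_wpM2r// addr_ge0//; exact: ipL2_ge0.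
Qed.

End error_process.

(** * Two samples *)

Lemma markov_ge0 (d : measure_display) (T : measurableType d) (R : realType)
    (mu : {measure set T -> \bar R}) (X : T -> R) (k : R) : 0 < k ->
  measurable_fun setT X -> (forall w, 0 <= X w) ->
  (mu [set w | (k <= X w)%R] <= k^-1%:E * \int[mu]_w (X w)%:E)%E.
Proof.
move=> k0 mX X0.
have := @le_integral_comp_abse _ T R mu setT measurableT (EFin \o X) k id
  (@measurable_id _ _ _) (fun _ h => h) (fun _ _ _ _ h => h).
move=> /(_ (proj2 (measurable_EFinP _ _) mX) k0); rewrite setTI => H.
rewrite -(@lee_pmul2l _ k%:E)// ?lte_fin// muleA -EFinM divff ?gt_eqF// mul1e.
rewrite (_ : [set w | _] = [set w | (k%:E <= `|(EFin \o X) w|)%E]).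
  apply: le_trans H _; rewrite le_eqVlt; apply/orP; left; apply/eqP/eq_integral => w _ /=.
  by rewrite ger0_norm.
by apply/seteqP; split => w /=; rewrite lee_fin ger0_norm.
Qed.

Lemma cvg_inv_nat (R : realType) (k : nat -> nat) :
  (forall K : nat, \forall n \near \oo, (K <= k n)%N) ->
  (fun n => (k n)%:R^-1 : R) @ \oo --> (0 : R).
Proof.
move=> kK; apply/cvgrPdist_le => e e0.
have := kK (Num.trunc e^-1).+1; apply: filterS => n kn.
rewrite sub0r normrN ger0_norm ?invr_ge0//.
have kn0 : (0 : R) < (k n)%:R by rewrite ltr0n; exact: leq_trans kn.
rewrite -[leRHS]invrK lef_pV2 ?posrE ?invr_gt0//.
apply: ltW; apply: lt_le_trans (truncnS_gt _) _.
by rewrite ler_nat.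
Qed.

Section two_samples.
Context {d dS dS' : measure_display} {Om : measurableType d} {S : measurableType dS}
  {S' : measurableType dS'} {R : realType} (P : probability Om R).
Variables (delta : int -> Om -> S) (deltac : nat -> int -> int -> Om -> S)
  (f : (nat -> S) -> R -> R) (delta' : int -> Om -> S')
  (deltac' : nat -> int -> int -> Om -> S') (f' : (nat -> S') -> R -> R)
  (mu mu' : R -> R).
Hypotheses (L2mu : L2fun mu) (L2mu' : L2fun mu').
Hypotheses (EA : error_assumptions P delta deltac f)
  (EA' : error_assumptions P delta' deltac' f').

Let V := measurableTypeR R.
Let lam : probability V R := uniform_prob (@ltr01 R).
Let Q : {measure set (Om * V)%type -> \bar R} := (P \x lam)%E.

Let a (t : V) : R := restr01 mu t - restr01 mu' t.

Let b (N M : nat) (p : Om * V) : R :=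
  N%:R^-1 * (\sum_(i < N) err01 delta f i.+1%:Z p) -
  M%:R^-1 * (\sum_(j < M) err01 delta' f' j.+1%:Z p).

Let sqint_a : sqint lam a.
Proof. by apply: sqintB; exact: sqint_restr01. Qed.

(** Lower case stands for functions, upper case for squared norms in time: [A], and below [D] for
    [a + b] and [B] for [b], the last two being random variables. *)
Let A := ipL2 lam a a.

Let AE : int01 (fun t => ((mu t - mu' t) ^+ 2)%:E) = A%:E.
Proof.
rewrite -integral_sqE// -int01_uniform; last by apply: measurable_funX; exact: sqint_a.1.
by apply: eq_int01 => t tI; rewrite /a !restr01_in.
Qed.

Let sqint_b N M : sqint Q (b N M).
Proof.
by apply: sqintB; apply: sqintZ; apply: sqint_sum => i; [exact: sqint_err01 EA _|
  exact: sqint_err01 EA' _].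
Qed.

Let sqint_bw N M w : sqint lam (fun t => b N M (w, t)).
Proof.
apply: sqintB; apply: sqintZ; apply: sqint_sum => i.
  by case: EA => _ _ [_ h] _;
    exact: (sqint_restr01 (h _ : L2fun (shift_proc delta f i.+1%:Z w))).
by case: EA' => _ _ [_ h] _;
    exact: (sqint_restr01 (h _ : L2fun (shift_proc delta' f' i.+1%:Z w))).
Qed.

Let D N M (w : Om) : R :=
  ipL2 lam (fun t => a t + b N M (w, t)) (fun t => a t + b N M (w, t)).

Let B N M (w : Om) : R := ipL2 lam (fun t => b N M (w, t)) (fun t => b N M (w, t)).

Let sample_mean_err (dS0 : measure_display) (S0 : measurableType dS0)
    (de : int -> Om -> S0) g m N w t : (0 < N)%N -> t \in `[(0:R), (1:R)] ->
  sample_mean m (shift_proc de g) N w t =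
  restr01 m t + N%:R^-1 * (\sum_(i < N) err01 de g i.+1%:Z (w, t)).
Proof.
move=> N0 tI; rewrite /sample_mean big_add1 /= big_mkord big_split /= mulrDr.
rewrite restr01_in// sumr_const card_ord -[m t *+ N]mulr_natl mulrA mulVf ?mul1r; last first.
  by rewrite pnatr_eq0 -lt0n.
by congr (_ + _ * _); apply: eq_bigr => i _; rewrite /err01 restr01_in.
Qed.

Let int01_diff N M w : (0 < N)%N -> (0 < M)%N ->
  int01 (fun t => ((sample_mean mu (shift_proc delta f) N w t
    - sample_mean mu' (shift_proc delta' f') M w t) ^+ 2)%:E) = (D N M w)%:E.
Proof.
move=> N0 M0; have sab := sqintD sqint_a (sqint_bw N M w).
rewrite -integral_sqE// -int01_uniform; last by apply: measurable_funX; exact: sab.1.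
apply: eq_int01 => t tI; rewrite !sample_mean_err// /a /b; congr (_ ^+ 2); ring.
Qed.

Let measurable_D N M : measurable_fun setT (D N M).
Proof.
apply/measurable_EFinP.
have -> : EFin \o D N M = fubini_F lam (fun p => ((a p.2 + b N M p) ^+ 2)%:E).
  apply/funext => w; rewrite /= /D -integral_sqE//.
  exact: sqintD sqint_a (sqint_bw N M w).
apply: measurable_fun_fubini_tonelli_F => [|p]; last by rewrite lee_fin sqr_ge0.
apply/measurable_EFinP/measurable_funX/measurable_funD; last exact: (sqint_b N M).1.
exact: (measurableT_comp sqint_a.1).
Qed.

Let fubini_B N M : EFin \o B N M = fubini_F lam (fun p => ((b N M p) ^+ 2)%:E).
Proof. by apply/funext => w; rewrite /= /B -integral_sqE. Qed.

Let measurable_B N M : measurable_fun setT (B N M).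
Proof.
apply/measurable_EFinP; rewrite fubini_B.
apply: measurable_fun_fubini_tonelli_F => [|p]; last by rewrite lee_fin sqr_ge0.
by apply/measurable_EFinP/measurable_funX; exact: (sqint_b N M).1.
Qed.

Let expectation_B N M : (\int[P]_w (B N M w)%:E)%E = (ipL2 Q (b N M) (b N M))%:E.
Proof.
rewrite -integral_sqE// [RHS]fubini_tonelli1.
- by rewrite -fubini_B.
- by apply/measurable_EFinP/measurable_funX; exact: (sqint_b N M).1.
- by move=> p; rewrite lee_fin sqr_ge0.
Qed.

(** A sum with square norm O(N) has a mean with square norm O(1/N), and the difference of the two
    means costs a factor 2. *)
Let b_le : exists C, forall N M, (0 < N)%N -> (0 < M)%N ->
  ipL2 Q (b N M) (b N M) <= C * (N%:R^-1 + M%:R^-1).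
Proof.
have mean_le x C N : (0 < N)%N -> sqint Q x -> ipL2 Q x x <= N%:R * C ->
    ipL2 Q (fun p => N%:R^-1 * x p) (fun p => N%:R^-1 * x p) <= C * N%:R^-1.
  move=> N0 sx xC; have sNx := sqintZ N%:R^-1 sx.
  rewrite ipL2Zl// ipL2C ipL2Zl//.
  apply: (@le_trans _ _ (N%:R^-1 * (N%:R^-1 * (N%:R * C)))).
    by rewrite !ler_wpM2l ?invr_ge0.
  by rewrite (mulrA _ N%:R) mulVf ?pnatr_eq0 -?lt0n// mul1r mulrC.
have [C xC] := err01_sum_le EA; have [C' yC] := err01_sum_le EA'.
(* The 2 comes from [ipL2_amgm] with [c = 1]. The absolute values make both constants non-negative,
   so that their sum can multiply both inverses. *)
exists (2 * (`|C| + `|C'|)) => N M N0 M0.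
set x := (fun p => \sum_(i < N) err01 delta f i.+1%:Z p) : Om * V -> R.
set y := (fun p => \sum_(i < M) err01 delta' f' i.+1%:Z p) : Om * V -> R.
have sx : sqint Q x by apply: sqint_sum => i; exact: sqint_err01 EA _.
have sy : sqint Q y by apply: sqint_sum => i; exact: sqint_err01 EA' _.
have hx := mean_le x C N N0 sx (xC N).
have hy := mean_le y C' M M0 sy (yC M).
have sNx := sqintZ N%:R^-1 sx; have sMy := sqintZ M%:R^-1 sy.
have bE : b N M = fun p => N%:R^-1 * x p + (- 1) * (M%:R^-1 * y p).
  by apply/funext => p; rewrite /b mulN1r.
have sNy := sqintZ (- 1) sMy.
rewrite bE ipL2_sqD//.
have := ipL2_amgm ltr01 sNx sNy.
rewrite invr1 !mul1r.
have -> : ipL2 Q (fun p => - 1 * (M%:R^-1 * y p)) (fun p => - 1 * (M%:R^-1 * y p)) =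
    ipL2 Q (fun p => M%:R^-1 * y p) (fun p => M%:R^-1 * y p).
  by rewrite ipL2Zl// ipL2C ipL2Zl// mulrA mulrNN !mul1r.
set xy := ipL2 Q _ (fun p => - 1 * _) => amgm.
have := ler_norm xy.
have : C * N%:R^-1 <= `|C| * N%:R^-1 by rewrite ler_wpM2r ?invr_ge0// ler_norm.
have : C' * M%:R^-1 <= `|C'| * M%:R^-1 by rewrite ler_wpM2r ?invr_ge0// ler_norm.
have : 0 <= `|C'| * N%:R^-1 by rewrite mulr_ge0 ?invr_ge0.
have : 0 <= `|C| * M%:R^-1 by rewrite mulr_ge0 ?invr_ge0.
move: hx hy amgm; rewrite mulrDr !mulrDl => *; lra.
Qed.

(** The difference is twice the inner product of [a] and [b], plus [B]; the former is bounded by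
    [ipL2_amgm]. *)
Let D_near_A c N M w : 0 < c -> `|D N M w - A| <= c * A + (1 + c^-1) * B N M w.
Proof.
move=> c0; have sb := sqint_bw N M w.
rewrite /D ipL2_sqD// -/A -/(B N M w).
rewrite (_ : A + _ + _ - A = 2 * ipL2 lam a (fun t => b N M (w, t)) + B N M w); last by ring.
have := ipL2_amgm c0 sqint_a sb; rewrite -/A -/(B N M w) => h.
apply: le_trans (ler_normD _ _) _; rewrite normrM (ger0_norm (ler0n _ _)).
rewrite (@ger0_norm _ (B N M w)); last exact: ipL2_ge0.
by rewrite mulrDl mul1r; lra.
Qed.

Let measurable_far e N M : measurable [set w | e < `|D N M w - A|].
Proof.
rewrite (_ : [set w | _] = (fun w => `|D N M w - A|) @^-1` `]e, +oo[).
  rewrite -(setTI (_ @^-1` _)).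
  have : measurable_fun setT (fun w => `|D N M w - A|).
    apply: measurableT_comp => //.
    by apply: measurable_funB => //; exact: measurable_D.
  by apply.
by apply/seteqP; split => w /=; rewrite in_itv/= andbT.
Qed.

Let far_prob_le e : 0 < e -> exists C, forall N M, (0 < N)%N -> (0 < M)%N ->
  (P [set w | (e < `|D N M w - A|)%R] <= (C * (N%:R^-1 + M%:R^-1))%:E)%E.
Proof.
move=> e0; have A0 : 0 <= A by exact: ipL2_ge0.
(* Chosen so that [c * A <= e / 2]; the [+ 1] covers [A = 0]. *)
pose c := e / (2 * (A + 1)).
have c0 : 0 < c by rewrite divr_gt0// mulr_gt0// ltr_wpDl.
have cA : c * A <= e / 2.
  rewrite /c invfM mulrA -mulrA ger_pMr ?divr_gt0// mulrC.
  by rewrite ler_pdivrMr ?mul1r ?ltr_wpDl//; lra.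
pose g := 1 + c^-1.
have g0 : 0 < g by rewrite addr_gt0// invr_gt0.
(* A deviation above [e] leaves more than [e / 2] to [g * B], hence [B >= k], and Markov's
   inequality applies. *)
pose k := e / 2 / g.
have k0 : 0 < k by rewrite !divr_gt0.
have [C bC] := b_le; exists (k^-1 * C) => N M N0 M0.
have B0 w : 0 <= B N M w by exact: ipL2_ge0.
apply: (@le_trans _ _ (P [set w | (k <= B N M w)%R])).
  apply: le_measure; rewrite ?inE.
  - exact: measurable_far.
  - rewrite (_ : [set w | _] = B N M @^-1` `[k, +oo[).
      by rewrite -(setTI (_ @^-1` _)); exact: measurable_B.
    by apply/seteqP; split => w /=; rewrite in_itv/= andbT.
  - move=> w /= ew; have := D_near_A N M w c0; rewrite -/g => h.
    by rewrite /k ler_pdivrMr// mulrC; lra.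
apply: le_trans (markov_ge0 P k0 (@measurable_B N M) B0) _.
rewrite expectation_B -EFinM lee_fin -mulrA.
by apply: ler_wpM2l; [rewrite invr_ge0 ltW|exact: bC].
Qed.

Lemma diff_prob_le e : 0 < e -> exists C, forall N M, (0 < N)%N -> (0 < M)%N ->
  (P [set w | e%:E < `|int01 (fun t => ((sample_mean mu (shift_proc delta f) N w t
    - sample_mean mu' (shift_proc delta' f') M w t) ^+ 2)%:E)
    - int01 (fun t => ((mu t - mu' t) ^+ 2)%:E)|] <= (C * (N%:R^-1 + M%:R^-1))%:E)%E.
Proof.
move=> /far_prob_le[C HC]; exists C => N M N0 M0.
apply: le_trans (HC N M N0 M0); rewrite le_eqVlt; apply/orP; left; apply/eqP.
congr (P _); apply/seteqP; split => w /=;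
  by rewrite AE int01_diff// -EFinB /= lte_fin.
Qed.

(** If [D <= K <= A / 3], then [D] is at least [2 * A / 3] away from [A], so [far_prob_le] applies
    with [e = A / 3]. Uniformity in [K] allows a threshold that varies with the sample sizes. *)
Lemma small_prob_le : (0 < int01 (fun t => ((mu t - mu' t) ^+ 2)%:E))%E ->
  exists C k, 0 < k /\ forall N M K, (0 < N)%N -> (0 < M)%N -> K <= k ->
  (P [set w | int01 (fun t => ((sample_mean mu (shift_proc delta f) N w t
    - sample_mean mu' (shift_proc delta' f') M w t) ^+ 2)%:E) <= K%:E]
    <= (C * (N%:R^-1 + M%:R^-1))%:E)%E.
Proof.
rewrite AE lte_fin => A0; have A3 : 0 < A / 3 by rewrite divr_gt0.
have [C HC] := far_prob_le A3; exists C, (A / 3); split => // N M K N0 M0 Kk.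
apply: le_trans (HC N M N0 M0); apply: le_measure; rewrite ?inE.
- rewrite (_ : [set w | _] = D N M @^-1` `]-oo, K]).
    by rewrite -(setTI (_ @^-1` _)); exact: measurable_D.
  by apply/seteqP; split => w /=; rewrite int01_diff// lee_fin in_itv.
- exact: measurable_far.
- move=> w /=; rewrite int01_diff// lee_fin => DK.
  by rewrite distrC; apply: lt_le_trans (ler_norm _); lra.
Qed.

End two_samples.

Lemma cvg_prob_le (R : realType) (p : nat -> \bar R) (C : R) (Nn Mn : nat -> nat) :
  (forall K : nat, \forall n \near \oo, (K <= minn (Nn n) (Mn n))%N) ->
  (forall n, (0 <= p n)%E) ->
  (\forall n \near \oo, (p n <= (C * ((Nn n)%:R^-1 + (Mn n)%:R^-1))%:E)%E) ->
  p @ \oo --> 0%E.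
Proof.
move=> minNM p0 pC.
have cN : (fun n => (Nn n)%:R^-1 : R) @ \oo --> (0 : R).
  apply: cvg_inv_nat => K; have := minNM K; apply: filterS => n.
  by rewrite leq_min => /andP[].
have cM : (fun n => (Mn n)%:R^-1 : R) @ \oo --> (0 : R).
  apply: cvg_inv_nat => K; have := minNM K; apply: filterS => n.
  by rewrite leq_min => /andP[].
apply: (@squeeze_cvge _ _ _ _ (cst 0%E) _
    (fun n => (C * ((Nn n)%:R^-1 + (Mn n)%:R^-1))%:E)).
- by apply: filterS pC => n ->; rewrite p0.
- exact: cvg_cst.
- apply: cvg_EFin; first exact: nearW.
  rewrite (_ : 0 = C * (0 + 0)); last by rewrite addr0 mulr0.
  by apply: cvgMr; exact: cvgD.
Qed.
Theorem theorem4 (R : realType) (d : measure_display) (Om : measurableType d)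
  (P : probability Om R)
  (dS : measure_display) (S : measurableType dS) (delta : int -> Om -> S)
  (deltac : nat -> int -> int -> Om -> S) (f : (nat -> S) -> R -> R)
  (dS' : measure_display) (S' : measurableType dS') (delta' : int -> Om -> S')
  (deltac' : nat -> int -> int -> Om -> S') (f' : (nat -> S') -> R -> R)
  (mu mu' : R -> R) (theta : R) (Nn Mn : nat -> nat) :
  L2fun mu -> L2fun mu' ->
  error_assumptions P delta deltac f ->
  error_assumptions P delta' deltac' f' ->
  indep_families P
    (fun p : nat * L2sub R => fun w => ip01 (shift_proc delta f p.1.+1%:Z w) (sval p.2))
    (fun p : nat * L2sub R => fun w => ip01 (shift_proc delta' f' p.1.+1%:Z w) (sval p.2)) ->
  (0 < int01 (fun t => ((mu t - mu' t) ^+ 2)%:E))%E ->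
  0 <= theta <= 1 ->
  (forall K : nat, \forall n \near \oo, (K <= minn (Nn n) (Mn n))%N) ->
  ((fun n => (Nn n)%:R / (Nn n + Mn n)%:R : R) @ \oo --> theta) ->
  let U n w := (((Nn n * Mn n)%:R / (Nn n + Mn n)%:R)%:E *
      int01 (fun t => ((sample_mean mu (shift_proc delta f) (Nn n) w t
                        - sample_mean mu' (shift_proc delta' f') (Mn n) w t) ^+ 2)%:E))%E in
  (forall e : R, 0 < e ->
     (fun n => P [set w | (e%:E < `| ((Nn n + Mn n)%:R / (Nn n * Mn n)%:R)%:E * U n w
                              - int01 (fun t => ((mu t - mu' t) ^+ 2)%:E) |)%E])
     @ \oo --> 0%E) /\
  (0 < theta < 1 ->
   forall K : R, (fun n => P [set w | (U n w <= K%:E)%E]) @ \oo --> 0%E).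
Proof.
move=> L2mu L2mu' EA EA' _ A0 _ minNM _ U.
(* An empty sample has mean 0 by the convention on inverses, so the decomposition of the means
   requires positive sizes. *)
have pos : \forall n \near \oo, (0 < Nn n)%N /\ (0 < Mn n)%N.
  by have := minNM 1%N; apply: filterS => n; rewrite leq_min => /andP.
split=> [e e0|_ K].
- have [C HC] := diff_prob_le L2mu L2mu' EA EA' e0.
  apply: (cvg_prob_le minNM (C := C)) => [n|]; first exact: measure_ge0.
  apply: filterS pos => n [N0 M0]; have := HC _ _ N0 M0.
  congr (_ <= _)%E; congr (P _); apply/funext => w; congr (_ < `|_ - _|)%E.
  rewrite /U muleA -EFinM mulrA divfK ?divff ?mul1e// pnatr_eq0 -lt0n ?muln_gt0 ?N0//.
  by rewrite addn_gt0 N0.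
- have [C [k [k0 HC]]] := small_prob_le L2mu L2mu' EA EA' A0.
  apply: (cvg_prob_le minNM (C := C)) => [n|]; first exact: measure_ge0.
  (* As NM/(N+M) is at least half the minimum, this makes the weight [q] at least [|K| / k], that
     is, it brings the rescaled threshold [K / q] below [k]. *)
  have big : \forall n \near \oo, (2 * (Num.trunc (`|K| / k)).+1 <= minn (Nn n) (Mn n))%N.
    exact: minNM.
  near=> n.
  have [N0 M0] : (0 < Nn n)%N /\ (0 < Mn n)%N by near: n.
  have : (2 * (Num.trunc (`|K| / k)).+1 <= minn (Nn n) (Mn n))%N by near: n.
  rewrite leq_min => /andP[bN bM].
  set q : R := (Nn n * Mn n)%:R / (Nn n + Mn n)%:R.
  have sR : (0 : R) < (Nn n + Mn n)%:R by rewrite ltr0n addn_gt0 N0.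
  have q0 : 0 < q by rewrite divr_gt0// ltr0n muln_gt0 N0.
  have Kq : `|K| / k <= q.
    apply: (@le_trans _ _ (Num.trunc (`|K| / k)).+1%:R); first exact/ltW/truncnS_gt.
    rewrite ler_pdivlMr// -natrM ler_nat.
    by move: bN bM; set z := _.+1 => bN bM; nia.
  have Kk : K / q <= k.
    rewrite ler_pdivrMr// mulrC -ler_pdivrMr//; apply: le_trans Kq.
    by rewrite ler_pM2r ?invr_gt0// ler_norm.
  have := HC _ _ _ N0 M0 Kk; congr (_ <= _)%E; congr (P _); apply/funext => w.
  (* Multiplying by [q] turns the event with threshold [K / q] into [U n w <= K]. *)
  congr is_true; rewrite /U -/q -[LHS](@lee_pmul2l _ q%:E) ?lte_fin//.
  by rewrite -EFinM mulrCA divff ?gt_eqF// mulr1.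
Unshelve. all: by end_near.
Qed.
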